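(* Let $\mathcal M$ be a map family, $\Gamma$ a constraint language and $R$ a relation. Then $R$ is $\mathcal M$-fgpp-definable over $\Gamma$ if and only if every partial multivalued operation that $\mathcal M$-preserves every relation of $\Gamma$ also $\mathrm{Id}$-preserves $R$.
   Context: Write $\underline{d}=\{0,\dots,d-1\}$. Relations have their own finite domain $\underline{d}$; a constraint language is a finite set of relations. A map family $\mathcal M$ assigns to every $(d,e)\in\mathbb N^2$ a set $\mathcal M_d^e$ of maps $\underline e\to\underline d$. $\mathrm{Id}$ is the map family with $\mathrm{Id}_d^d=\{\text{identity on }\underline d\}$ and $\mathrm{Id}_d^e=\emptyset$ for $d\ne e$. A relation $R\subseteq\underline{n}^r$ is $\mathcal M$-fgpp-definable over $\Gamma$ if $R=\{x\in\underline n^r: \varphi(x)\}$ where $\varphi$ is a finite conjunction of atoms $S(h_1(x_{j_1}),\dots,h_s(x_{j_s}))$ with $S\in\Gamma$ of arity $s$ and domain $\underline e$, indices $j_i\in\{1,\dots,r\}$, and maps $h_i\in\mathcal M_e^n$ (no quantifiers, no equality atoms). A partial multivalued operation of arity $k$ on domain $D$ is a function $f:D^k\to 2^D$ ($f(x)=\emptyset$ meaning undefined). For a set $M$ of maps $D\to E$ define $f_M:E^k\to 2^E$ by $f_M(y_1,\dots,y_k)=\bigcup_{m\in M}\{m(z): z\in f(x_1,\dots,x_k),\ x_i\in D,\ m(x_i)=y_i\text{ for all }i\}$. A multivalued operation $g$ of arity $k$ on $E$ preserves $R\subseteq E^r$ if for all $t_1,\dots,t_k\in R$, every tuple $u\in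 E^r$ with $u[j]\in g(t_1[j],\dots,t_k[j])$ for all $j$ belongs to $R$. An operation $f$ on $\underline{e}$ $\mathcal M$-preserves a relation $R$ with domain $\underline d$ if $f_M$ preserves $R$ where $M=\mathcal M_d^e$. *)

(* Defs.v *)
From HB Require Import structures.
From mathcomp Require Import all_boot finmap.

Set Implicit Arguments.
Unset Strict Implicit.
Unset Printing Implicit Defensive.

(* Each relation carries its own domain {0, ..., rdom - 1} and arity; both may
   be 0. *)
Record fin_relation := FinRelation {
  rdom : nat;
  rarity : nat;
  rset : {set rarity.-tuple 'I_rdom}
}.

Definition fin_relation_pack (R : fin_relation) :
    {d : nat & {r : nat & {set r.-tuple 'I_d}}} :=
  Tagged (fun d => {r : nat & {set r.-tuple 'I_d}})
    (Tagged (fun r => {set r.-tuple 'I_(rdom R)}) (rset R)).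

Definition fin_relation_unpack
    (p : {d : nat & {r : nat & {set r.-tuple 'I_d}}}) : fin_relation :=
  FinRelation (tagged (tagged p)).

Lemma fin_relation_packK : cancel fin_relation_pack fin_relation_unpack.
Proof. by case. Qed.

HB.instance Definition _ := Choice.copy fin_relation
  (can_type fin_relation_packK).

Definition constraint_language := {fset fin_relation}.

(* [M d e] is the set M_d^e of maps from {0, ..., e-1} to {0, ..., d-1}: the
   codomain comes first. *)
Definition map_family := forall d e : nat, {set {ffun 'I_e -> 'I_d}}.

(* Values are compared in nat because 'I_d and 'I_e are different types; the
   test [d == e] excludes the inclusions of 'I_e in 'I_d for e < d. *)
Definition Id_family : map_family :=
  fun d e => [set h : {ffun 'I_e -> 'I_d} |
               (d == e) && [forall x, nat_of_ord (h x) == nat_of_ord x]].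

(* An atom S(h_1(x_{j_1}), ..., h_s(x_{j_s})) in the variables x_1, ..., x_r
   ranging over {0, ..., n-1}. *)
Record atom (n r : nat) := Atom {
  atom_rel : fin_relation;
  atom_map : 'I_(rarity atom_rel) -> {ffun 'I_n -> 'I_(rdom atom_rel)};
  atom_idx : 'I_(rarity atom_rel) -> 'I_r
}.

Arguments atom_map {n r} a i : rename.
Arguments atom_idx {n r} a i : rename.

Definition atom_over (M : map_family) (Gamma : constraint_language)
    (n r : nat) (a : atom n r) : bool :=
  (atom_rel a \in Gamma) &&
  [forall i, atom_map a i \in M (rdom (atom_rel a)) n].

Definition atom_holds (n r : nat) (a : atom n r) (x : r.-tuple 'I_n) : bool :=
  [tuple atom_map a i (tnth x (atom_idx a i)) | i < rarity (atom_rel a)]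
    \in rset (atom_rel a).

(* A conjunction is a list of atoms; the empty list is the true formula. *)
Definition fgpp_definable (M : map_family) (Gamma : constraint_language)
    (R : fin_relation) : Prop :=
  exists phi : seq (atom (rdom R) (rarity R)),
    all (fun a => atom_over M Gamma a) phi /\
    rset R = [set x | all (fun a => atom_holds a x) phi].

(* The arity k may be 0: nullary operations are needed to separate the empty
   relation, which every operation of positive arity preserves. *)
Definition pmop (D k : nat) := k.-tuple 'I_D -> {set 'I_D}.

(* The operation f_M. *)
Definition pmop_image (D E k : nat) (M : {set {ffun 'I_D -> 'I_E}})
    (f : pmop D k) : pmop E k :=
  fun y => \bigcup_(m in M)
             \bigcup_(x : k.-tuple 'I_D | [forall i, m (tnth x i) == tnth y i])
               [set m z | z in f x].

Definition preserves (E k r : nat) (g : pmop E k) (R : {set r.-tuple 'I_E}) :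
    Prop :=
  forall t : 'I_k -> r.-tuple 'I_E, (forall l, t l \in R) ->
  forall u : r.-tuple 'I_E,
    (forall j : 'I_r, tnth u j \in g [tuple tnth (t l) j | l < k]) ->
    u \in R.

Definition M_preserves (M : map_family) (e k : nat) (f : pmop e k)
    (R : fin_relation) : Prop :=
  preserves (pmop_image (M (rdom R) e) f) (rset R).

(* Main.v *)
Require Import Defs.
From mathcomp Require Import all_boot finmap.

Set Implicit Arguments.
Unset Strict Implicit.
Unset Printing Implicit Defensive.

(* The conjunction of all atoms over Gamma that hold throughout R defines R.
   Indeed, let t_1, ..., t_k enumerate R, let u satisfy this conjunction, and
   let f send each column (t_1[j], ..., t_k[j]) to the values u[j'] over all j'
   with the same column. An instance of f_M applied to tuples of S in Gamma is
   precisely an atom over Gamma that holds at every t_l, and its result lies in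
   S because that atom also holds at u; so f M-preserves Gamma. Since f
   Id-preserves R and can produce u from t_1, ..., t_k, u belongs to R. *)

Lemma pmop_imageP (D E k : nat) (M : {set {ffun 'I_D -> 'I_E}})
    (f : pmop D k) (y : k.-tuple 'I_E) (v : 'I_E) :
  reflect (exists m x z, [/\ m \in M, forall i, m (tnth x i) = tnth y i,
                             z \in f x & v = m z])
          (v \in pmop_image M f y).
Proof.
apply: (iffP bigcupP) => [[m Mm /bigcupP[x /forallP xy /imsetP[z fz ->]]]|].
  by exists m, x, z; split=> // i; apply/eqP.
move=> [m [x [z [Mm xy fz ->]]]]; exists m => //.
apply/bigcupP; exists x; last exact: imset_f.
by apply/forallP=> i; apply/eqP.
Qed.

Lemma mem_Id_family n (m : {ffun 'I_n -> 'I_n}) :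
  (m \in Id_family n n) = [forall x, m x == x].
Proof. by rewrite inE eqxx. Qed.

(** The identity is the only available map, so [Id]-preservation of a relation on the domain of [f]
    is ordinary preservation by [f]. *)
Lemma pmop_image_Id n k (f : pmop n k) (y : k.-tuple 'I_n) :
  pmop_image (Id_family n n) f y = f y.
Proof.
apply/setP=> v; apply/pmop_imageP/idP => [[m [x [z [+ xy fz ->]]]]|fv].
  rewrite mem_Id_family => /forallP mK.
  rewrite (eqP (mK z)); suff -> : y = x by [].
  by apply: eq_from_tnth => i; rewrite -xy (eqP (mK _)).
exists [ffun x => x], y, v; split=> // [|i|]; rewrite ?ffunE //.
by rewrite mem_Id_family; apply/forallP=> x; rewrite ffunE.
Qed.

(** For [e] different from [n] the family is empty and no such [v] exists; otherwise [v] is a value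
    of [f] at [y], and [h] itself witnesses that [h v] is a value of the image. *)
Lemma pmop_image_comp_Id (e n d k : nat) (M : map_family) (f : pmop e k)
    (h : {ffun 'I_n -> 'I_d}) (y : k.-tuple 'I_n) (v : 'I_n) :
  h \in M d n -> v \in pmop_image (Id_family n e) f y ->
  h v \in pmop_image (M d e) f [tuple h (tnth y l) | l < k].
Proof.
move=> Mh fv; have en : n = e.
  by case/pmop_imageP: fv => m [_ [_ [+ _ _ _]]]; rewrite inE => /andP[/eqP].
subst e; move: fv; rewrite pmop_image_Id => fv.
by apply/pmop_imageP; exists h, y, v; split=> // i; rewrite tnth_mktuple.
Qed.

(** Each atom can be treated separately: its maps carry the [t l] to tuples of a relation in
    [Gamma], and [u] to a tuple that the image of [f] produces from these. *)
Lemma fgpp_definable_preserved (M : map_family) (Gamma : constraint_language)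
    (R : fin_relation) (e k : nat) (f : pmop e k) :
  fgpp_definable M Gamma R ->
  (forall S, S \in Gamma -> M_preserves M f S) ->
  M_preserves Id_family f R.
Proof.
move=> [phi [phiM Rphi]] fGamma t tR u ut.
have {tR} tphi l : all (fun a => atom_holds a (t l)) phi.
  by have := tR l; rewrite Rphi inE.
rewrite Rphi inE {Rphi}.
elim: phi phiM tphi => //= a phi IHphi /andP[/andP[aGamma /forallP aM] phiM] tphi.
rewrite {}IHphi ?andbT // => [|l]; last by case/andP: (tphi l).
pose s l := [tuple atom_map a i (tnth (t l) (atom_idx a i))
            | i < rarity (atom_rel a)].
apply: (fGamma _ aGamma s) => [l|i]; first by case/andP: (tphi l).
rewrite tnth_mktuple.
have := pmop_image_comp_Id (aM i) (ut (atom_idx a i)).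
congr (_ \in pmop_image _ _ _); apply: eq_from_tnth => l.
by rewrite !tnth_mktuple.
Qed.

(** With finite functions, the choices of maps and indices form a finite type and can be
    enumerated. *)
Definition ffun_atom n r (S : fin_relation)
    (p : {ffun 'I_(rarity S) -> {ffun 'I_n -> 'I_(rdom S)}} *
         {ffun 'I_(rarity S) -> 'I_r}) : atom n r := Atom p.1 p.2.

Definition language_atoms (Gamma : constraint_language) n r :
    seq (atom n r) :=
  [seq @ffun_atom n r Q p | Q <- enum_fset Gamma, p <- enum {: _ * _}].

(** Completeness of the enumeration is phrased through [all], because [atom] contains plain
    functions and carries no equality test. *)
Lemma all_language_atoms (Gamma : constraint_language) n r
    (P : pred (atom n r)) (S : fin_relation)
    (h : {ffun 'I_(rarity S) -> {ffun 'I_n -> 'I_(rdom S)}})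
    (j : {ffun 'I_(rarity S) -> 'I_r}) :
  S \in Gamma -> all P (language_atoms Gamma n r) -> P (Atom h j).
Proof.
by move=> GammaS /all_allpairsP/(_ S (h, j)); apply; rewrite ?mem_enum.
Qed.

Definition theory_of (M : map_family) (Gamma : constraint_language)
    (R : fin_relation) : seq (atom (rdom R) (rarity R)) :=
  [seq a <- language_atoms Gamma (rdom R) (rarity R)
  | atom_over M Gamma a & [forall x in rset R, atom_holds a x]].

Definition column_op n r k (t : 'I_k -> r.-tuple 'I_n) (u : r.-tuple 'I_n) :
    pmop n k :=
  fun y => [set tnth u j | j : 'I_r & y == [tuple tnth (t l) j | l < k]].

Lemma column_op_preserves (M : map_family) (Gamma : constraint_language)
    (R : fin_relation) k (t : 'I_k -> (rarity R).-tuple 'I_(rdom R)) u :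
  (forall x, x \in rset R -> exists l, t l = x) ->
  all (fun a => atom_holds a u) (theory_of M Gamma R) ->
  forall S, S \in Gamma -> M_preserves M (column_op t u) S.
Proof.
move=> tR uR S GammaS s sS v vs.
(* Each entry of [v] yields a map and a position of [u]; collected over all [i], they are the data
   of one atom on [S]. *)
have /fin_all_exists[p pP] i :
    exists p : {ffun 'I_(rdom R) -> 'I_(rdom S)} * 'I_(rarity R),
    [/\ p.1 \in M (rdom S) (rdom R),
        forall l, p.1 (tnth (t l) p.2) = tnth (s l) i
      & tnth v i = p.1 (tnth u p.2)].
  case/pmop_imageP: (vs i) => m [x [z [Mm mx + ->]]].
  case/imsetP=> j; rewrite inE => /eqP xj ->; exists (m, j); split=> //= l.
  by have := mx l; rewrite xj !tnth_mktuple.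
move: uR; rewrite all_filter => uR.
have := all_language_atoms [ffun i => (p i).1] [ffun i => (p i).2] GammaS uR.
rewrite /= /atom_over GammaS /=.
have -> /= : [forall i, [ffun i => (p i).1] i \in M (rdom S) (rdom R)].
  by apply/forallP=> i; rewrite ffunE; case: (pP i).
set a := Atom _ _.
(* Every tuple of [R] is some [t l], and there the atom evaluates to [s l]; at [u] it evaluates to
   [v]. *)
have -> /= : [forall x in rset R, atom_holds a x].
  apply/forall_inP=> x /tR[l <-]; have := sS l.
  congr (_ \in rset S); apply: eq_from_tnth => i.
  by rewrite tnth_mktuple /= !ffunE; case: (pP i) => _ ->.
congr (_ \in rset S); apply: eq_from_tnth => i.
by rewrite tnth_mktuple /= !ffunE; case: (pP i) => _ _ ->.
Qed.

Lemma preserved_fgpp_definable (M : map_family) (Gamma : constraint_language)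
    (R : fin_relation) :
  (forall (e k : nat) (f : pmop e k),
     (forall S, S \in Gamma -> M_preserves M f S) ->
     M_preserves Id_family f R) ->
  fgpp_definable M Gamma R.
Proof.
move=> presR; exists (theory_of M Gamma R); split.
  by rewrite all_filter; apply: sub_all (all_predT _) => a _ /=; apply/implyP => /andP[].
apply/setP=> u; rewrite inE; apply/idP/idP => [Ru|uR].
  rewrite all_filter; apply: sub_all (all_predT _) => a _ /=.
  by apply/implyP => /andP[_ /forall_inP]; apply.
(* If [R] is empty, the operation is nullary and its values are all the entries of [u]. *)
pose t (l : 'I_#|rset R|) := enum_val l.
have tR x : x \in rset R -> exists l, t l = x.
  by move=> Rx; exists (enum_rank_in Rx x); rewrite /t enum_rankK_in.
apply: (presR _ _ _ (column_op_preserves tR uR) t) => [l|j].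
  exact: enum_valP.
by rewrite pmop_image_Id; apply/imsetP; exists j; rewrite ?inE.
Qed.

Theorem mainTheorem6 (M : map_family) (Gamma : constraint_language)
    (R : fin_relation) :
  fgpp_definable M Gamma R <->
  (forall (e k : nat) (f : pmop e k),
     (forall S : fin_relation, S \in Gamma -> M_preserves M f S) ->
     M_preserves Id_family f R).
Proof.
split=> [defR e k f|]; first exact: fgpp_definable_preserved.
exact: preserved_fgpp_definable.
Qed.
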